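(* Let $n\ge4$ and $k\ge1$ be integers. Then \[ \gamma_{[k]R}(C_7\Box P_n)\le 7(n-2)\left\lceil\frac{k+4}{5}\right\rceil+14\left\lceil\frac{k+3-\left\lceil\frac{k+4}{5}\right\rceil}{3}\right\rceil . \]
   Context: For a graph $G$ and $v\in V(G)$, $N(v)$ is the open neighborhood and $N[v]=N(v)\cup\{v\}$. For an integer $k\ge1$, a function $f:V(G)\to\{0,1,\dots,k+1\}$ is a $[k]$-Roman dominating function if for every vertex $v$ with $f(v)<k$ we have $\sum_{u\in N[v]}f(u)\ge k+|\{u\in N(v): f(u)>0\}|$. The weight of $f$ is $\sum_{v}f(v)$, and $\gamma_{[k]R}(G)$ is the minimum weight of a $[k]$-Roman dominating function on $G$. $C_m\Box P_n$ is the Cartesian product of the cycle $C_m$ (vertices $0,\dots,m-1$ mod $m$) and the path $P_n$ (vertices $0,\dots,n-1$): $(i,j)\sim(i',j')$ iff ($i=i'$ and $|j-j'|=1$) or ($j=j'$ and $i'\equiv i\pm1 \pmod m$). *)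

(* Defs.v *)
From HB Require Import structures.
From mathcomp Require Import all_boot all_order all_algebra.

Set Implicit Arguments.
Unset Strict Implicit.
Unset Printing Implicit Defensive.

Import Order.TTheory GRing.Theory Num.Theory.

Local Open Scope nat_scope.

(* A finite simple graph is given by its adjacency relation
   [e : rel T] (symmetric and irreflexive) on its finite vertex type [T]. *)

Section RomanDomination.

Variables (T : finType) (e : rel T).

Definition open_nbh (v : T) : {set T} := [set u | e v u].

Definition closed_nbh (v : T) : {set T} := v |: open_nbh v.

(* The value set {0, 1, ..., k+1} is ['I_k.+2]. *)
Definition roman_dominating (k : nat) (f : {ffun T -> 'I_k.+2}) : bool :=
  [forall v, (f v < k) ==>
     (k + #|[set u in open_nbh v | 0 < f u]| <= \sum_(u in closed_nbh v) f u)].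

Definition weight (k : nat) (f : {ffun T -> 'I_k.+2}) : nat := \sum_v f v.

(* The default [ffun=> ord_max] of the minimisation, the function with constant
   value k+1, is itself [k]-Roman dominating (see [roman_dominating_max]), so
   this is a genuine minimum (see [gamma_leq] and [gamma_attained]). *)
Definition gamma (k : nat) : nat :=
  weight [arg min_(f < [ffun=> ord_max] | @roman_dominating k f) weight f].

Lemma roman_dominating_max k :
  @roman_dominating k [ffun=> ord_max].
Proof.
by apply/forallP => v; apply/implyP; rewrite ffunE /= ltnNge leqnSn.
Qed.

Lemma gamma_leq k (f : {ffun T -> 'I_k.+2}) :
  roman_dominating f -> gamma k <= weight f.
Proof.
rewrite /gamma; case: arg_minnP => [|g _ gmin]; last exact: gmin.
exact: roman_dominating_max.
Qed.

Lemma gamma_attained k :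
  exists2 f : {ffun T -> 'I_k.+2}, roman_dominating f & weight f = gamma k.
Proof.
rewrite /gamma; case: arg_minnP => [|g gR _]; last by exists g.
exact: roman_dominating_max.
Qed.

End RomanDomination.

(* [cycle_adj m] is the adjacency of C_m when 3 <= m. *)
Definition cycle_adj (m : nat) : rel 'I_m :=
  [rel i j : 'I_m | (j == i + 1 %[mod m]) || (i == j + 1 %[mod m])].

Definition path_adj (n : nat) : rel 'I_n :=
  [rel i j : 'I_n | (j == i + 1 :> nat) || (i == j + 1 :> nat)].

Definition box_adj (T1 T2 : finType) (e1 : rel T1) (e2 : rel T2) :
    rel (T1 * T2) :=
  [rel x y : T1 * T2 |
     ((x.1 == y.1) && e2 x.2 y.2) || ((x.2 == y.2) && e1 x.1 y.1)].

Lemma cycle_adj_sym m : symmetric (@cycle_adj m).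
Proof. by move=> i j; exact: orbC. Qed.

Lemma cycle_adj_irr m : 1 < m -> irreflexive (@cycle_adj m).
Proof.
move=> m1 i; rewrite /cycle_adj /= orbb -[X in X == _ %[mod m]]addn0 eqn_modDl.
by rewrite mod0n modn_small.
Qed.

Lemma path_adj_sym n : symmetric (@path_adj n).
Proof. by move=> i j; exact: orbC. Qed.

Lemma path_adj_irr n : irreflexive (@path_adj n).
Proof. by move=> i; rewrite /path_adj /= orbb addn1 ltn_eqF. Qed.

Lemma box_adj_sym (T1 T2 : finType) (e1 : rel T1) (e2 : rel T2) :
  symmetric e1 -> symmetric e2 -> symmetric (box_adj e1 e2).
Proof.
move=> s1 s2 x y.
by rewrite /box_adj /= s1 s2 [x.1 == _]eq_sym [x.2 == _]eq_sym.
Qed.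

Lemma box_adj_irr (T1 T2 : finType) (e1 : rel T1) (e2 : rel T2) :
  irreflexive e1 -> irreflexive e2 -> irreflexive (box_adj e1 e2).
Proof. by move=> i1 i2 x; rewrite /box_adj /= i1 i2 !andbF. Qed.

Definition ceil_div (a b : int) : int := Num.ceil (a%:Q / b%:Q)%R.

(* Main.v *)
(* Take a = ceil((k+4)/5) on the interior cycles and b = ceil((k+3-a)/3) on the
   two end cycles.  The closed neighbourhood sums are 3b + a >= k + 3 at the
   ends, where the degree is 3, and 5a, 4a + b or 3a + 2b inside, where the
   degree is 4; these are all at least k + 4, since b >= a unless k = 2, in
   which case a = 2 and b = 1. *)
Require Import Defs.
From mathcomp Require Import all_boot all_order all_algebra.
From mathcomp Require Import zify.

Import Order.TTheory GRing.Theory Num.Theory.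
Local Open Scope ring_scope.

(** Clearing the denominator turns the rational ceiling into integer bounds, linear for a literal
    [d]. *)
Lemma ceil_divP (m d : int) : 0 < d ->
  (ceil_div m d - 1) * d < m <= ceil_div m d * d.
Proof.
move=> d0; have d0Q : 0 < d%:Q by rewrite ltr0z.
have /andP[lo hi] := ceil_itv (m%:Q / d%:Q).
by rewrite -(ltr_int rat) -(ler_int rat) !intrM -ltr_pdivlMr // -ler_pdivrMr // lo.
Qed.

Local Open Scope nat_scope.

(** Neighbours are split by whether their first coordinate is [v.1]; irreflexivity of [e1] makes
    this exactly the split into the two factors. *)
Lemma sum_open_box (T1 T2 : finType) (e1 : rel T1) (e2 : rel T2)
    (F : T1 * T2 -> nat) (v : T1 * T2) : irreflexive e1 ->
  \sum_(u in open_nbh (box_adj e1 e2) v) F u =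
  \sum_(i | e1 v.1 i) F (i, v.2) + \sum_(j | e2 v.2 j) F (v.1, j).
Proof.
case: v => i j /= irr1.
rewrite (bigID (fun u => u.1 == i)) /= addnC; congr (_ + _).
  (* The fixed coordinate is written as a one-term sum, so that both sides range over pairs. *)
  under [RHS]eq_bigr => i' _ do
    rewrite -[F _](big_pred1_eq addn j (fun j' => F (i', j'))).
  rewrite pair_big /=; apply: eq_big => [[i' j']|[]] //=.
  rewrite inE /box_adj /= (eq_sym i) (eq_sym j).
  by case: eqVneq => [->|_]; rewrite ?irr1 ?andbF ?andbT /= 1?andbC.
rewrite -[RHS](big_pred1_eq addn i (fun i' => \sum_(j' | e2 j j') F (i', j'))).
rewrite pair_big /=; apply: eq_big => [[i' j']|[]] //=.
rewrite inE /box_adj /= (eq_sym i).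
by case: eqVneq => [->|_]; rewrite ?irr1 ?andbF ?orbF ?andbT.
Qed.

Lemma sum_closed (T : finType) (e : rel T) (F : T -> nat) (v : T) :
  irreflexive e ->
  \sum_(u in closed_nbh e v) F u = F v + \sum_(u in open_nbh e v) F u.
Proof. by move=> irr; rewrite big_setU1 // inE irr. Qed.

Lemma sum_cycle7 (i : 'I_7) (c : nat) : \sum_(i' | cycle_adj i i') c = 2 * c.
Proof.
rewrite sum_nat_const -sum1_card; congr (_ * _).
rewrite big_mkcond !big_ord_recl big_ord0.
by case: i => -[|[|[|[|[|[|[|]]]]]]].
Qed.

(** Taking [g] on [nat] lets [j.-1] and [j.+1] appear without bound proofs. The guards drop the
    missing neighbour at each end. *)
Lemma sum_path n (g : nat -> nat) (j : 'I_n) :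
  \sum_(j' | path_adj j j') g j' =
  (if 0 < j then g j.-1 else 0) + (if j.+1 < n then g j.+1 else 0).
Proof.
rewrite (bigID (fun j' : 'I_n => j' < j)) /=; congr (_ + _).
  case: ifP => j0; last by rewrite big_pred0 // => j'; rewrite /path_adj /=; lia.
  have jn : j.-1 < n by have := ltn_ord j; lia.
  rewrite (big_pred1 (Ordinal jn)) // => j'.
  by rewrite /path_adj /= -val_eqE /=; lia.
case: ifP => jn; last by rewrite big_pred0 // => j';
  rewrite /path_adj /=; have := ltn_ord j'; lia.
rewrite (big_pred1 (Ordinal jn)) // => j'.
by rewrite /path_adj /= -val_eqE /=; lia.
Qed.

Lemma gamma_cycle7_path (n k a b : nat) :
  2 < n -> a <= k.+1 -> b <= k.+1 -> k + 3 <= 3 * b + a ->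
  k + 4 <= 5 * a -> k + 4 <= 4 * a + b -> k + 4 <= 3 * a + 2 * b ->
  gamma (box_adj (@cycle_adj 7) (@path_adj n)) k <=
    7 * (n - 2) * a + 14 * b.
Proof.
move=> n3 ak bk end_sum in5 in41 in32.
pose g (j : nat) : nat := if (j == 0) || (j == n.-1) then b else a.
have gk j : g j <= k.+1 by rewrite /g; case: ifP.
pose f : {ffun 'I_7 * 'I_n -> 'I_k.+2} := [ffun u : 'I_7 * 'I_n => inord (g u.2)].
have fE u : f u = g u.2 :> nat by rewrite ffunE inordK // ltnS.
have irr1 := @cycle_adj_irr 7 isT.
have irr : irreflexive (box_adj (@cycle_adj 7) (@path_adj n)).
  exact: box_adj_irr irr1 (@path_adj_irr n).
have fR : roman_dominating (box_adj (@cycle_adj 7) (@path_adj n)) f.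
  apply/forallP => v; apply/implyP => _.
  (* The number of positive neighbours is bounded by the degree, which is then computed as a sum of
     ones by the same neighbourhood formulas. *)
  apply: (@leq_trans (k + #|open_nbh (box_adj (@cycle_adj 7) (@path_adj n)) v|)).
    rewrite leq_add2l subset_leq_card //.
    by apply/subsetP => u; rewrite inE => /andP[].
  rewrite -sum1_card sum_closed // !sum_open_box // fE.
  under [X in _ <= _ + (X + _)]eq_bigr do rewrite fE /=.
  under [X in _ <= _ + (_ + X)]eq_bigr do rewrite fE /=.
  rewrite !sum_cycle7 (sum_path _ (fun=> 1)) sum_path /g.
  have := ltn_ord v.2; move: (nat_of_ord v.2) => j jn.
  (* The cases are the position of [j] and of its neighbours relative to the ends; [in32] serves a
     cycle lying between both end cycles. *)
  by do ![case: ifP => ?]; lia.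
apply: leq_trans (gamma_leq fR) _.
rewrite /weight; under eq_bigr do rewrite fE.
rewrite -(pair_bigA _ (fun _ (j : 'I_n) => g j)) /= sum_nat_const card_ord.
(* With the length in the form [n.+2], the first and last terms peel off as [b], leaving [n]
   interior terms equal to [a]. *)
case: n n3 @g gk f fE {irr fR} => [|[|n]] // n3 g gk f fE.
rewrite big_ord_recl big_ord_recr /= /g /= eqxx.
rewrite (eq_bigr (fun=> a)) => [|i _].
  by rewrite sum_nat_const card_ord; lia.
by rewrite /bump /=; have := ltn_ord i; case: ifP => //; lia.
Qed.

Local Open Scope ring_scope.

Theorem theorem15 (n k : nat) (hn : (4 <= n)%N) (hk : (1 <= k)%N) :
  (gamma (box_adj (@cycle_adj 7) (@path_adj n)) k)%:Z
    <= 7 * (n%:Z - 2) * ceil_div (k%:Z + 4) 5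
       + 14 * ceil_div (k%:Z + 3 - ceil_div (k%:Z + 4) 5) 3.
Proof.
have := @ceil_divP (k%:Z + 4) 5 isT.
set a := ceil_div (k%:Z + 4) 5 => aP.
have := @ceil_divP (k%:Z + 3 - a) 3 isT.
set b := ceil_div _ 3 => bP.
(* Nonnegativity allows both ceilings to be replaced by natural numbers. *)
have [a0 b0] : 0 <= a /\ 0 <= b by lia.
have := @gamma_cycle7_path n k `|a|%N `|b|%N.
move: (gamma _ k) a b a0 b0 aP bP => w [a|//] [b|//] _ _ aP bP.
rewrite !absz_nat => H.
have {}H : (w <= 7 * (n - 2) * a + 14 * b)%N by apply: H; lia.
(* As [n] is at least 2, truncated [n - 2] agrees with the integer difference. *)
by nia.
Qed.
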